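(* Consider labeled chip-firing on the self-loop graph starting with $n$ chips with distinct labels from a totally ordered set, all at site $0$, where $n\equiv 3 \pmod 4$. When the process terminates (every site has at most $2$ chips), the chips are in weakly sorted order: for any chips $a<b$, the final position of $a$ is at most the final position of $b$, regardless of the choices of firing moves made.
   Context: The self-loop graph is the path graph on $\mathbb{Z}$ (each $i$ adjacent to $i\pm1$) with one self-loop at every vertex. A labeled firing move chooses three chips at a common site $i$; the one with the smallest label moves to $i-1$, the one with the largest label moves to $i+1$, and the third stays at $i$. *)

(* Defs.v *)
From mathcomp Require Import all_boot all_order all_algebra.
Set Implicit Arguments. Unset Strict Implicit. Unset Printing Implicit Defensive.
Import Order.TTheory GRing.Theory Num.Theory.

(* Labeled chip-firing on the self-loop graph (path on Z, a loop at every vertex).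
   Chips are indexed by 'I_n; chip x carries label [lab x] in a totally ordered
   type T (lab injective = distinct labels).  A configuration is the position map
   'I_n -> int. *)

Section ChipFiring.
Variables (d : Order.disp_t) (T : orderType d) (n : nat) (lab : 'I_n -> T).

Definition config := 'I_n -> int.

Definition fire_step (p q : config) : Prop :=
  exists a b c : 'I_n,
    [/\ (lab a < lab b)%O, (lab b < lab c)%O,
        p a = p b, p b = p c &
        q = (fun x => if x == a then (p a - 1)%R
                      else if x == c then (p c + 1)%R
                      else p x)].

Inductive reachable (p : config) : config -> Prop :=
| reach_refl : reachable p p
| reach_step q r : reachable p q -> fire_step q r -> reachable p r.

Definition terminal (p : config) : Prop :=
  forall i : int, #|[set x | p x == i]| <= 2.

End ChipFiring.

(* Main.v *)
Require Import Defs.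
From mathcomp Require Import all_boot all_order all_algebra.
From mathcomp Require Import zify.
Import Order.TTheory GRing.Theory Num.Theory.

(** Write n = 4K - 1.  Whatever the choices, site i fires (K - |i|)_+^2 times in
    total; let r(i) be the number of its firings still to come.  Fix a cut s with
    -K < s <= 0 and call the 2(K + s) - 1 chips of smallest label small, the
    others large: these are the chips that must end at sites < s, resp. >= s.
    The following two inequalities hold at all times:
    - at most r(i) large chips are at sites <= i, for every i < s;
    - at most (r(v) + s - min(v, 0))_+ small chips are at sites >= v, for v >= s.
    When the process stops r = 0, so the first one says that the cut is sorted.

    Firing a triple with both kinds of chips at x lowers both sides of the
    inequalities at x by one, so only a monochromatic triple can break them.
    If one did, then comparing the number of chips at x with the second
    difference of r forces r to have an abnormal slope near x.  Since an interval
    [a, b] of fired sites always holds at least 2(b - a) + 1 chips, such a slope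
    persists up to a site that has not fired yet, and r is large.  This
    contradicts a quadratic bound on the total distance of the large chips to the
    left (small chips to the right) of a site, which holds because second
    differences of the bound are at most 2 while a monochromatic firing needs 3
    chips.  Cuts to the right of the origin follow by reflection. *)

Section Firing.
Local Open Scope ring_scope.

(** * The final odometer and its differences *)

Definition odo (K x : int) : int := Num.max 0 (K - `|x|) ^+ 2.

Definition remaining (K : int) (U : int -> int) (x : int) : int := odo K x - U x.

Lemma odo_le0 (K x : int) : x <= 0 -> - K <= x -> odo K x = (K + x) ^+ 2.
Proof. by move=> ? ?; rewrite /odo; congr (_ ^+ 2); lia. Qed.

Lemma odo_ge0 (K x : int) : 0 <= x -> x <= K -> odo K x = (K - x) ^+ 2.
Proof. by move=> ? ?; rewrite /odo; congr (_ ^+ 2); lia. Qed.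

Lemma odo_out (K x : int) : K <= `|x| -> odo K x = 0.
Proof.
by move=> ?; rewrite /odo (_ : Num.max 0 _ = 0) ?expr0n //; lia.
Qed.

Lemma odo_diff (K x : int) : - K < x -> x <= K ->
  odo K x - odo K (x - 1) = 2 * (K + x) - 1 - 4 * K * (1 <= x)%R%:Z.
Proof.
move=> xK Kx; case: (leP 1 x) => x1.
  by rewrite !odo_ge0 ?expr2; [nia | lia..].
by rewrite !odo_le0 ?expr2; [nia | lia..].
Qed.

(** Adding the 4K - 1 chips that start at 0, this is the final configuration: two chips at each site
    with 0 < |x| < K, and one at 0. *)
Lemma odo_diff2 (K x : int) : - K < x -> x < K ->
  odo K (x - 1) + odo K (x + 1) - 2 * odo K x = 2 - 4 * K * (x == 0)%:Z.
Proof.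
move=> xK Kx; have := odo_diff K x xK (ltW Kx).
have := odo_diff K (x + 1); rewrite addrK; nia.
Qed.

Lemma odo_diff2_le (K x : int) : 1 <= K ->
  odo K (x - 1) + odo K (x + 1) - 2 * odo K x <= 2 - 4 * K * (x == 0)%:Z.
Proof.
move=> K1; case: (ltP `|x| K) => [xK|Kx]; first by rewrite odo_diff2 //; lia.
rewrite (odo_out _ _ Kx).
case: (ltP 0 x) => x0.
  rewrite (odo_out K (x + 1)); last by lia.
  case: (eqVneq x K) => [->|xK].
    by rewrite odo_ge0 ?expr2; nia.
  by rewrite odo_out; lia.
rewrite (odo_out K (x - 1)); last by lia.
case: (eqVneq x (- K)) => [->|xK].
  by rewrite odo_le0 ?expr2; nia.
by rewrite odo_out; lia.
Qed.

(** * Profiles of configurations and the invariant *)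

Set Implicit Arguments.

(** [P x] is the sum of (p - x)_+ over the positions p of small chips, [Q x] the
    sum of (x - p)_+ over those of large chips, and [U x] the number of firings
    at x.  Hence [P (v - 1) - P v] small chips are at sites >= v,
    [Q (i + 1) - Q i] large chips are at sites <= i, and second differences count
    the chips at a site. *)
Record chip_profile (K s : int) (P Q U : int -> int) : Prop := ChipProfile {
  P_ge0 : forall x : int, 0 <= P x;
  Q_ge0 : forall x : int, 0 <= Q x;
  P_decr : forall x : int, P x <= P (x - 1);
  P_convex : forall x : int, 0 <= P (x - 1) + P (x + 1) - 2 * P x;
  Q_convex : forall x : int, 0 <= Q (x - 1) + Q (x + 1) - 2 * Q x;
  P_slope : forall x : int, P (x - 1) - P x <= 2 * (K + s) - 1;
  balance : forall x : int, Q x - Q (x - 1) - (P (x - 1) - P x) + (2 * (K + s) - 1)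
    = U x - U (x - 1) + (4 * K - 1) * (1 <= x)%R%:Z }.

(** [recurrent]: of two adjacent fired sites, the one that fired first for the last
    time later received a chip from the other, and a fired site is never empty;
    hence one chip per site and one more per edge of [a, b]. *)
Record chip_invariant (K s : int) (P Q U : int -> int) : Prop := ChipInvariant {
  Q_bound : forall x : int, 4 * Q x <= Num.max 0 (2 * x + K - s) ^+ 2;
  P_bound : forall x : int, 4 * P x <= Num.max 0 (K + s - 2 * x) ^+ 2;
  U_ge0 : forall x : int, 0 <= U x;
  U_le : forall x : int, U x <= odo K x;
  recurrent : forall a b : int, a <= b ->
    (forall i : int, a <= i -> i <= b -> 1 <= U i) ->
    2 * (b - a) + 1 <=
    U (b + 1) - U b + U (a - 1) - U a + (4 * K - 1) * (a <= 0 <= b)%R%:Z;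
  large_left : forall i : int, i < s -> Q (i + 1) - Q i <= remaining K U i;
  small_right : forall v : int, s <= v ->
    P (v - 1) - P v <= Num.max 0 (remaining K U v + s - Num.min v 0) }.

Unset Implicit Arguments.

(** * Monotonicity and searches on the integers *)

Lemma antitone_seg (g : int -> int) (a : int) (k : nat) :
  (forall x : int, a <= x -> x < a + k%:Z -> g (x + 1) <= g x) ->
  g (a + k%:Z) <= g a.
Proof.
elim: k => [|k IH] H; first by rewrite addr0.
have := H (a + k%:Z); have -> : a + k%:Z + 1 = a + k.+1%:Z by lia.
have : g (a + k%:Z) <= g a by apply: IH => x ? ?; apply: H; lia.
lia.
Qed.

Lemma antitone_int (g : int -> int) (a b : int) :
  a <= b -> (forall x : int, a <= x -> x < b -> g (x + 1) <= g x) -> g b <= g a.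
Proof.
move=> ab H; have E : b = a + `|b - a|%N%:Z by lia.
by rewrite E; apply: antitone_seg => x ? ?; apply: H; lia.
Qed.

Lemma first_right (f : int -> bool) (a b : int) : a <= b -> f b ->
  exists2 c, a <= c <= b & f c /\ forall x : int, a <= x -> x < c -> ~~ f x.
Proof.
move=> ab fb.
have ex : exists k : nat, f (a + k%:Z).
  by exists `|b - a|%N; have -> : a + `|b - a|%N%:Z = b by lia.
have [k fk kmin] := ex_minnP ex.
exists (a + k%:Z).
  have := kmin `|b - a|%N; have -> : a + `|b - a|%N%:Z = b by lia.
  by move=> /(_ fb) ?; lia.
split=> // x ax xk; apply/negP => fx.
have := kmin `|x - a|%N; have -> : a + `|x - a|%N%:Z = x by lia.
by move=> /(_ fx); lia.
Qed.

Lemma first_left (f : int -> bool) (a b : int) : b <= a -> f b ->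
  exists2 c, b <= c <= a & f c /\ forall x : int, c < x -> x <= a -> ~~ f x.
Proof.
move=> ba fb.
have [||c ? [fc cmin]] := first_right (fun x => f (- x)) (- a) (- b).
- lia.
- by rewrite opprK.
exists (- c); first lia.
by split=> // x ? ?; have := cmin (- x); rewrite opprK; apply; lia.
Qed.

(** * A single firing and the quadratic bound *)

Set Implicit Arguments.

(** Small labels come first, so a triple is described by two booleans:
    [al] (resp. [ga]) tells whether the chip moving left (resp. right) is small. *)
Record fires (x : int) (al ga : bool) (P Q U P' Q' U' : int -> int) : Prop := Fires {
  fires_P : forall i : int,
    P' i = P i - (al && (i < x)%R)%:Z + (ga && (i <= x)%R)%:Z;
  fires_Q : forall i : int,
    Q' i = Q i + (~~ al && (x <= i)%R)%:Z - (~~ ga && (x < i)%R)%:Z;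
  fires_U : forall i : int, U' i = U i + (i == x)%:Z;
  fires_order : ga -> al;
  fires_small : 2 * ga%:Z + al%:Z <= P (x - 1) + P (x + 1) - 2 * P x;
  fires_large : 2 * (~~ al)%:Z + (~~ ga)%:Z <= Q (x - 1) + Q (x + 1) - 2 * Q x;
  fires_total : 3 <= P (x - 1) + P (x + 1) - 2 * P x +
    (Q (x - 1) + Q (x + 1) - 2 * Q x) }.

Unset Implicit Arguments.

(** The parabola (2x + c)^2 / 4 has second difference 2, so a second difference of at least 3 keeps
    F strictly below it and leaves room for the unit that a firing adds. *)
Lemma quarter_square (F : int -> int) (c x : int) : (forall y, 0 <= F y) ->
  (forall y, 4 * F y <= Num.max 0 (2 * y + c) ^+ 2) ->
  3 <= F (x - 1) + F (x + 1) - 2 * F x ->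
  4 * (F x + 1) <= Num.max 0 (2 * x + c) ^+ 2.
Proof.
move=> F0 Fb Fx; have := Fb (x - 1); have := Fb (x + 1); have := F0 x.
rewrite !expr2 => Fx0.
case: (leP 2 (2 * x + c)) => w; last first.
  (* Here 2x + c <= 1, and the bounds at x - 1 and x + 1 are too small for a second difference of
     3. *)
  case: (leP (2 * x + c) (-1)) => w1; first nia.
  have [->|->] : c = - 2 * x \/ c = 1 - 2 * x by lia.
    nia.
  nia.
have -> : Num.max 0 (2 * (x + 1) + c) = 2 * x + c + 2 by lia.
have -> : Num.max 0 (2 * (x - 1) + c) = 2 * x + c - 2 by lia.
have -> : Num.max 0 (2 * x + c) = 2 * x + c by lia.
set y := 2 * x + c; move=> ? ?.
(* y ^ 2 is 0 or 1 modulo 4, so the bound y ^ 2 - 2 improves to y ^ 2 - 4. *)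
have : 4 * F x <= y * y - 2 by nia.
have [z [yE|yE]] : exists z : int, y = 2 * z \/ y = 2 * z + 1.
  by exists (y %/ 2)%Z; lia.
all: rewrite yE; lia.
Qed.

(** * Slopes of the remaining firings *)

Section Static.
Variables (K s : int) (P Q U : int -> int).
Hypotheses (K1 : 1 <= K) (sK : - K < s) (s0 : s <= 0).
Hypotheses (sh : chip_profile K s P Q U) (iv : chip_invariant K s P Q U).
Local Notation r := (remaining K U).

Lemma remaining_ge0 (x : int) : 0 <= r x.
Proof. by have := U_le iv x; rewrite /remaining; lia. Qed.

Lemma remaining_le (x : int) : r x <= odo K x.
Proof. by have := U_ge0 iv x; rewrite /remaining; lia. Qed.

Lemma remaining_out (x : int) : K <= `|x| -> r x = 0.
Proof.
move=> Kx; have := remaining_ge0 x; have := remaining_le x.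
by rewrite odo_out //; lia.
Qed.

Lemma remaining_end (x : int) : `|x| = K - 1 -> r x <= 1.
Proof.
move=> xK; have := remaining_le x; case: (leP 0 x) => x0.
  by rewrite odo_ge0 ?expr2; [nia | lia..].
by rewrite odo_le0 ?expr2; [nia | lia..].
Qed.

Lemma balance_remaining (x : int) : - K < x -> x <= K ->
  Q x - Q (x - 1) - (P (x - 1) - P x) =
  r (x - 1) - r x + 2 * (x - s) - (1 <= x)%R%:Z.
Proof.
move=> xK Kx; have := balance sh x; have := odo_diff K x xK Kx.
by rewrite /remaining; case: (leP 1 x) => _ /=; lia.
Qed.

Lemma balance2 (x : int) : P (x - 1) + P (x + 1) - 2 * P x +
  (Q (x - 1) + Q (x + 1) - 2 * Q x) =
  U (x - 1) + U (x + 1) - 2 * U x + (4 * K - 1) * (x == 0)%:Z.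
Proof.
have := balance sh x; have := balance sh (x + 1).
rewrite addrK; case: (leP 1 x); case: (leP 1 (x + 1)); case: (eqVneq x 0) => /=; lia.
Qed.

(** The chips at x are the final ones, two or, at the origin, one, plus the net number that the
    remaining firings take away. *)
Lemma balance2_remaining (x : int) : - K < x -> x < K ->
  P (x - 1) + P (x + 1) - 2 * P x + (Q (x - 1) + Q (x + 1) - 2 * Q x) =
  2 - (x == 0)%:Z + 2 * r x - r (x - 1) - r (x + 1).
Proof.
move=> xK Kx; rewrite balance2; have := odo_diff2 K x xK Kx.
by rewrite /remaining; case: (eqVneq x 0) => _ /=; lia.
Qed.

(** In the end [a, b] holds 2(b - a + 1) chips, one fewer if it contains 0; the drops of r across
    its two ends are the surplus over that number, and [recurrent] guarantees 2(b - a) + 1 chips. *)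
Lemma recurrent_remaining (a b : int) : - K < a -> a <= b -> b < K ->
  (forall i, a <= i -> i <= b -> 1 <= U i) ->
  (a <= 0 <= b)%R%:Z - 1 <= r a - r (a - 1) + (r b - r (b + 1)).
Proof.
move=> aK ab bK fired; have := recurrent iv a b ab fired.
have := odo_diff K a aK (ltW (le_lt_trans ab bK)).
have := odo_diff K (b + 1); rewrite addrK /remaining.
by case: (leP a 0) => a0; case: (leP 0 b) => b0 /=;
   case: (leP 1 a); case: (leP 1 (b + 1)) => /=; lia.
Qed.

Lemma unfired_right (u : int) : u < K ->
  exists2 B, u < B <= K & r B = odo K B /\ forall x, u < x -> x < B -> 1 <= U x.
Proof.
move=> uK; have [||B uB [UB minB]] := first_right (fun x => U x == 0) (u + 1) K.
- lia.
- have := U_le iv K; have := U_ge0 iv K.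
  by rewrite odo_out; lia.
exists B; first lia.
split=> [|x ux xB]; first by rewrite /remaining (eqP UB) subr0.
by have := minB x; have := U_ge0 iv x; lia.
Qed.

Lemma unfired_left (u : int) : - K < u ->
  exists2 B, - K <= B < u & r B = odo K B /\ forall x, B < x -> x < u -> 1 <= U x.
Proof.
move=> uK; have [||B uB [UB minB]] := first_left (fun x => U x == 0) (u - 1) (- K).
- lia.
- have := U_le iv (- K); have := U_ge0 iv (- K).
  by rewrite odo_out; lia.
exists B; first lia.
split=> [|x ux xB]; first by rewrite /remaining (eqP UB) subr0.
by have := minB x; have := U_ge0 iv x; lia.
Qed.

(** The bound on [u + 1, b] turns the slope at u into a slope at b, for every b up
    to the first unfired site B, where r equals [odo K B]. *)
Lemma descent_left (u d : int) : u < 0 -> 1 <= d -> d <= r u - r (u + 1) ->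
  exists2 B, 0 < B < K & (K - B) ^+ 2 + d * B <= r (u + 1).
Proof.
move=> u0 d1 du.
have uK : - K < u.
  case: (ltP (- K) u) => // uK.
  by have := remaining_out u; have := remaining_ge0 (u + 1); lia.
have [|B uB [rB fired]] := unfired_right u; first lia.
have step (b : int) : u < b -> b < B -> d - 1 + (0 <= b)%R%:Z <= r b - r (b + 1).
  move=> ub bB; have := recurrent_remaining (u + 1) b; rewrite addrK => H.
  have := H ltac:(lia) ltac:(lia) ltac:(lia) ltac:(by move=> *; apply: fired; lia).
  by nia.
(* The final odometer increases up to 0, so B <= 0 would give r(B) = [odo K B] > [odo K u] >= r(u),
   although r descends from u to B. *)
have B0 : 0 < B.
  case: (ltP 0 B) => // B0.
  have : r B <= r (u + 1).
    by apply: antitone_int => [|x ux xB]; [lia | have := step x; lia].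
  have := remaining_le u; rewrite rB !odo_le0 ?expr2; try lia.
  nia.
have BK : B < K.
  case: (ltP B K) => // KB.
  have := step (K - 1); have := fired (K - 1); rewrite subrK.
  have := remaining_out K; have := remaining_end (K - 1).
  have := odo_ge0 K (K - 1); rewrite /remaining expr2.
  nia.
exists B; first lia.
(* Left of the origin only monotonicity is kept; each edge right of it lowers r by d. *)
have : r B + d * Num.max 0 B <= r (u + 1) + d * Num.max 0 (u + 1).
  apply: (antitone_int (fun x => r x + d * Num.max 0 x)) => [|x ux xB]; first lia.
  by have := step x; nia.
by rewrite rB odo_ge0; nia.
Qed.

Lemma descent_left1 (u : int) : u < 0 -> 1 <= r u - r (u + 1) -> K <= r (u + 1).
Proof.
move=> u0 du; have [|//|B BK] := descent_left u 1 u0; first lia.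
rewrite expr2; nia.
Qed.

(** (K - B)^2 + 2B = (K - B - 1)^2 + 2K - 1. *)
Lemma descent_left2 (u : int) : u < 0 -> 2 <= r u - r (u + 1) ->
  2 * K - 1 <= r (u + 1).
Proof.
move=> u0 du; have [|//|B BK] := descent_left u 2 u0; first lia.
rewrite expr2; nia.
Qed.

(** As in [descent_left], but [u + 1, b] no longer contains the origin, so the slope that persists
    is only d - 1. *)
Lemma descent_right (u d : int) : 0 <= u -> 2 <= d -> d <= r u - r (u + 1) ->
  exists2 B, u < B < K & (K - B) ^+ 2 + (d - 1) * (B - u - 1) <= r (u + 1).
Proof.
move=> u0 d1 du.
have uK : u < K - 1.
  case: (ltP u (K - 1)) => // uK.
  have := remaining_out u; have := remaining_ge0 (u + 1).
  have := remaining_end u; lia.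
have [|B uB [rB fired]] := unfired_right u; first lia.
have step (b : int) : u < b -> b < B -> d - 1 <= r b - r (b + 1).
  move=> ub bB; have := recurrent_remaining (u + 1) b; rewrite addrK => H.
  have := H ltac:(lia) ltac:(lia) ltac:(lia) ltac:(by move=> *; apply: fired; lia).
  by nia.
have BK : B < K.
  case: (ltP B K) => // KB.
  have := step (K - 1); have := fired (K - 1); rewrite subrK.
  have := remaining_out K; have := odo_ge0 K (K - 1); rewrite /remaining expr2.
  nia.
exists B; first lia.
have : r B + (d - 1) * B <= r (u + 1) + (d - 1) * (u + 1).
  apply: (antitone_int (fun x => r x + (d - 1) * x)) => [|x ux xB]; first lia.
  by have := step x; nia.
by rewrite rB odo_ge0; nia.
Qed.

Lemma descent_right2 (u : int) : 0 <= u -> 2 <= r u - r (u + 1) ->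
  K - u - 1 <= r (u + 1).
Proof.
move=> u0 du; have [|//|B BK] := descent_right u 2 u0; first lia.
rewrite expr2; nia.
Qed.

Lemma descent_right3 (u : int) : 0 <= u -> 3 <= r u - r (u + 1) ->
  2 * (K - u) - 3 <= r (u + 1).
Proof.
move=> u0 du; have [|//|B BK] := descent_right u 3 u0; first lia.
rewrite expr2; nia.
Qed.

(** The mirrored argument on the intervals [a, s - 1]: r loses at least one per site down to an
    unfired B, where (K + B)^2 >= K + B. *)
Lemma ascent_left : 2 <= r s - r (s - 1) -> K + s - 1 <= r (s - 1).
Proof.
move=> ds.
have sK1 : - K + 1 < s.
  by case: (ltP (- K + 1) s) => // ?; have := remaining_out (s - 1);
     have := remaining_end s; have := remaining_out s;
     have := remaining_ge0 (s - 1); lia.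
have [//|B uB [rB fired]] := unfired_left s.
have step (a : int) : B < a -> a < s -> 1 <= r a - r (a - 1).
  move=> Ba a_s; have := recurrent_remaining a (s - 1); rewrite subrK => H.
  have := H ltac:(lia) ltac:(lia) ltac:(lia) ltac:(by move=> *; apply: fired; lia).
  by nia.
have BK : - K < B.
  case: (ltP (- K) B) => // KB.
  have E : B = - K by lia.
  have := step (- K + 1); have := fired (- K + 1); rewrite addrK.
  have := remaining_out (- K); have := odo_le0 K (- K + 1); rewrite /remaining expr2.
  nia.
have : (s - 1) - r (s - 1) <= B - r B.
  apply: (antitone_int (fun x => x - r x)) => [|x ux xB]; first lia.
  by have := step (x + 1); rewrite addrK; lia.
by rewrite rB odo_le0 ?expr2; nia.
Qed.

(** * Lower bounds for the growth of P and Q *)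

Lemma P_slope_mono (a b : int) : a <= b -> P (b - 1) - P b <= P (a - 1) - P a.
Proof.
move=> ab; apply: (antitone_int (fun x => P (x - 1) - P x)) => // x _ _.
by rewrite addrK; have := P_convex sh x; lia.
Qed.

Lemma Q_slope_mono (a b : int) : a <= b -> Q (a + 1) - Q a <= Q (b + 1) - Q b.
Proof.
move=> ab.
have : Q b - Q (b + 1) <= Q a - Q (a + 1).
  apply: (antitone_int (fun x => Q x - Q (x + 1))) => // x _ _.
  by have := Q_convex sh (x + 1); rewrite addrK; lia.
lia.
Qed.

(** At least as many small chips are at sites >= x + 1 as at sites >= t, so the balance at x + 1
    bounds the large chips at sites <= x from below; this is summed over b <= x < t. *)
Lemma Q_lower (b t : int) : - K <= b -> b <= t -> t <= 0 ->
  (t - b) * (P (t - 1) - P t + t + b + 1 - 2 * s) + r b - r t <= Q t - Q b.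
Proof.
move=> Kb bt t0; set W := P (t - 1) - P t.
pose g x := W * x - r x + x * x + x - 2 * s * x - Q x.
suff : g t <= g b by rewrite /g; nia.
apply: antitone_int => // x bx xt; rewrite /g.
have := P_slope_mono (x + 1) t; have := balance_remaining (x + 1).
rewrite addrK -/W; nia.
Qed.

(** The mirror image, using that at least as many large chips are at sites <= x as at sites <= u. *)
Lemma P_lower (u b : int) : 0 <= u -> u <= b -> b <= K ->
  (b - u) * (P u - P (u + 1) + r u - r (u + 1) - (b - u - 1)) + r b - r u
    <= P u - P b.
Proof.
move=> u0 ub bK; set W := P u - P (u + 1) + r u - r (u + 1).
pose g x := P x + W * x - x * x + x + 2 * u * x + r x.
suff : g b <= g u by rewrite /g; nia.
apply: antitone_int => // x ux xb; rewrite /g.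
have := Q_slope_mono u x.
have := balance_remaining (x + 1); have := balance_remaining (u + 1).
rewrite !addrK /W; nia.
Qed.

(** * Monochromatic triples *)

(** Equality in [large_left] at x, with the bound at x - 1 and the chip count at x, would force r(x
    + 1) < r(x); but at least r(x) large chips are then at sites <= x + 1. *)
Lemma small_triple_left (x : int) : x < s - 1 -> 1 <= r x ->
  3 <= P (x - 1) + P (x + 1) - 2 * P x -> Q (x + 1) - Q x <= r x - 1.
Proof.
move=> xs rx zx.
have xK : - K < x by case: (ltP (- K) x) => // ?; have := remaining_out x; lia.
have := balance2_remaining x; have := large_left iv x.
have := large_left iv (x - 1); have := large_left iv (x + 1).
have := Q_convex sh (x + 1); rewrite addrK subrK.
lia.
Qed.

Lemma large_triple_left (x : int) : x < s -> 1 <= r x ->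
  3 <= Q (x - 1) + Q (x + 1) - 2 * Q x -> Q x - Q (x - 1) + 1 <= r (x - 1).
Proof.
move=> xs rx ox.
have xK : - K < x by case: (ltP (- K) x) => // ?; have := remaining_out x; lia.
have := large_left iv x; have := large_left iv (x - 1).
have := large_left iv (x - 1 - 1); rewrite !subrK.
case: (ltP (- K + 1) x) => xK1; last first.
  by have := remaining_end x; have := remaining_ge0 (x - 1); lia.
have := balance2_remaining (x - 1); have := P_convex sh (x - 1).
rewrite subrK; lia.
Qed.

(** By [ascent_left] at least K + s + 1 small chips are at sites >= s, and [Q_lower] then makes Q(s)
    too large. *)
Lemma large_triple_cut : 1 <= r s -> 2 <= r s - r (s - 1) ->
  r s <= P (s - 1) - P s ->
  4 * (Q s + 1) <= Num.max 0 (2 * s + K - s) ^+ 2 -> False.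
Proof.
move=> rs ds Zs.
have -> : Num.max 0 (2 * s + K - s) = K + s by lia.
have R := ascent_left ds.
(* [Q_lower] over l + 1 sites gives Q(s) >= l(K + s - l); halving K + s turns this into the integer
   part of (K + s)^2 / 4. *)
pose l := ((K + s) %/ 2)%Z.
have lE : 2 * l <= K + s <= 2 * l + 1 by rewrite /l; lia.
have := Q_lower (s - l - 1) s; have := Q_ge0 sh (s - l - 1).
have := remaining_ge0 (s - l - 1); rewrite expr2.
nia.
Qed.

(** Otherwise the bounds at s - 1 and s are both tight, r drops from s - 1 to s, and [descent_left1]
    gives r(s) >= K. So many small chips force Q(s) above [Q_bound]. *)
Lemma small_triple_cut : 1 <= r (s - 1) ->
  3 <= P (s - 1 - 1) + P (s - 1 + 1) - 2 * P (s - 1) ->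
  P (s - 1) - P s + 1 <= r s.
Proof.
move=> rs zs.
have sK1 : - K < s - 1.
  by case: (ltP (- K) (s - 1)) => // ?; have := remaining_out (s - 1); lia.
rewrite leNgt; apply/negP => Zs.
have bal := balance_remaining s.
have cs := balance2_remaining (s - 1).
have ll1 := large_left iv (s - 1).
have ll2 := large_left iv (s - 1 - 1).
rewrite !subrK in zs cs ll1 ll2.
have rsK : K <= r s.
  by have := descent_left1 (s - 1); rewrite subrK; lia.
have := Q_bound iv s.
have -> : Num.max 0 (2 * s + K - s) = K + s by lia.
pose l := ((K + s) %/ 2)%Z.
have lE : 2 * l <= K + s <= 2 * l + 1 by rewrite /l; lia.
have := Q_lower (s - 1 - l) (s - 1); have := Q_ge0 sh (s - 1 - l).
have := remaining_ge0 (s - 1 - l); rewrite expr2.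
nia.
Qed.

(** If this fails, the bound at x is tight, and the bound at x - 1 (at the cut, [large_triple_cut])
    limits the slope of r. The chip count then needs the bound at x + 1 to be truncated to 0, so r
    drops to a value too small for the descent lemmas, unless x is so far right that [P_bound]
    leaves no small chip there. *)
Lemma large_triple_right (x : int) : s <= x -> 1 <= r x ->
  3 <= Q (x - 1) + Q (x + 1) - 2 * Q x ->
  4 * (Q x + 1) <= Num.max 0 (2 * x + K - s) ^+ 2 ->
  P (x - 1) - P x <= Num.max 0 (r x - 1 + s - Num.min x 0).
Proof.
move=> sx rx ox Qx; rewrite leNgt; apply/negP => Zx.
have Zx_le := small_right iv x sx.
have xK : x < K by case: (ltP x K) => // ?; have := remaining_out x; lia.
have cx := balance2_remaining x ltac:(lia) xK.
have Z1_le := small_right iv (x + 1) ltac:(lia).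
have Z1_ge := P_decr sh (x + 1).
rewrite addrK in Z1_le Z1_ge.
have r1 := remaining_ge0 (x + 1).
case: (eqVneq x s) => [xs|xs].
  subst x.
  have bal := balance_remaining s sK ltac:(lia).
  have ds : r s - r (s - 1) <= 1.
    rewrite leNgt; apply/negP => ds.
    by apply: large_triple_cut => //; lia.
  case: (ltP s 0) => s1; last lia.
  have d1 : K <= r (s + 1) by apply: descent_left1; lia.
  lia.
have xs1 : s < x by lia.
have Z0_le := small_right iv (x - 1) ltac:(lia).
have Z0_ge : P (x - 1) - P x <= P (x - 1 - 1) - P (x - 1).
  by apply: P_slope_mono; lia.
case: (ltP x 0) => x0.
  have d1 : K <= r (x + 1) by apply: descent_left1; lia.
  lia.
have d2 : K - x - 1 <= r (x + 1) by apply: descent_right2; lia.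
have xKs : K + s <= x by lia.
have := P_bound iv (x - 1); have := P_ge0 sh x.
rewrite expr2; nia.
Qed.

(** If this fails, r drops by at least 2 after x, by 3 if x >= 0. For x < 0 the descent would
    require more small chips than exist; for x >= 0 it makes P(x) too large through [P_lower]. *)
Lemma small_triple_right (x : int) : s <= x -> 1 <= r x ->
  3 <= P (x - 1) + P (x + 1) - 2 * P x ->
  4 * (P x + 1) <= Num.max 0 (K + s - 2 * x) ^+ 2 ->
  P x - P (x + 1) + 1 <= Num.max 0 (r (x + 1) + s - Num.min (x + 1) 0).
Proof.
move=> sx rx zx Px; rewrite leNgt; apply/negP => Z1.
have Zx_le := small_right iv x sx.
have Z1_ge := P_decr sh (x + 1).
have Zm := P_slope sh x.
rewrite addrK in Z1_ge.
have xK : x < K by case: (ltP x K) => // ?; have := remaining_out x; lia.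
case: (ltP x 0) => x0.
  have d2 : 2 * K - 1 <= r (x + 1) by apply: descent_left2; lia.
  lia.
have d3 : 2 * (K - x) - 3 <= r (x + 1) by apply: descent_right3; lia.
have xm : 2 <= K + s - 2 * x.
  rewrite leNgt; apply/negP => xm; move: Px; have := P_ge0 sh x.
  rewrite expr2; nia.
have := P_lower x (K + s); have := P_ge0 sh (K + s).
have := remaining_ge0 (K + s).
(* As x >= 0, the bound may be weakened to the distance from x to K + s, the length over which
   [P_lower] is summed. *)
have : 4 * (P x + 1) <= (K + s - x) ^+ 2.
  by apply: le_trans Px _; rewrite !expr2; nia.
move=> Pe rK PK /(_ x0 ltac:(lia) ltac:(lia)); move: Pe.
pose e := K + s - x; pose X := P x - P (x + 1) + r x - r (x + 1).
have -> : K + s - x = e by [].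
rewrite -/X expr2 => Pe PL.
have XE : 2 * e - s <= X by rewrite /X /e; lia.
have rX : r x <= X - s by rewrite /X; lia.
have e2 : 2 <= e by rewrite /e; lia.
have : 0 <= (e - 1) * (X - (2 * e - s)) by apply: mulr_ge0; lia.
have : 0 <= (- s) * (e - 2) by apply: mulr_ge0; lia.
have : 0 <= (e - 2) * (e - 2) by apply: mulr_ge0; lia.
clearbody e X; lia.
Qed.

(** * Preservation under a firing *)

Section Step.
Variables (P' Q' U' : int -> int) (x : int) (al ga : bool).
Hypotheses (sh' : chip_profile K s P' Q' U').
Hypotheses (st : fires x al ga P Q U P' Q' U').
Local Notation r' := (remaining K U').

(** Least action: if x had already fired [odo K x] times, then, its neighbours being within their
    totals, it would hold at most two chips and could not fire. *)
Lemma step_U_le y : U' y <= odo K y.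
Proof.
have Uy := U_le iv; rewrite (fires_U st).
case: (eqVneq y x) => [->|_] /=; last by have := Uy y; lia.
have := odo_diff2_le K x K1; have := balance2 x.
have := fires_total st; have := Uy x; have := Uy (x - 1); have := Uy (x + 1).
case: (eqVneq x 0) => [->|_] /=; lia.
Qed.

Lemma step_U_ge0 y : 0 <= U' y.
Proof. by have := U_ge0 iv y; rewrite (fires_U st); lia. Qed.

Lemma step_remaining y : r' y = r y - (y == x)%:Z.
Proof. by rewrite /remaining (fires_U st); lia. Qed.

Lemma fired_remaining_gt0 : 1 <= r x.
Proof.
by have := step_U_le x; rewrite (fires_U st) eqxx /remaining /=; lia.
Qed.

Lemma step_Q_bound y : 4 * Q' y <= Num.max 0 (2 * y + K - s) ^+ 2.
Proof.
have Qb := Q_bound iv; rewrite (fires_Q st).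
have ord := fires_order st; have := fires_large st.
case: al ga ord => [] [] ord /= Qx; try by have := ord isT.
- by have := Qb y; lia.
- by have := Qb y; lia.
case: (eqVneq y x) => [->|yx]; last by have := Qb y; lia.
have Qb' z : 4 * Q z <= Num.max 0 (2 * z + (K - s)) ^+ 2 by rewrite addrA.
by have := quarter_square Q _ x (Q_ge0 sh) Qb'; rewrite addrA; lia.
Qed.

Lemma step_P_bound y : 4 * P' y <= Num.max 0 (K + s - 2 * y) ^+ 2.
Proof.
have Pb := P_bound iv; rewrite (fires_P st).
have ord := fires_order st; have := fires_small st.
case: al ga ord => [] [] ord /= Px; try by have := ord isT.
- case: (eqVneq y x) => [->|yx]; last by have := Pb y; lia.
  (* P is reflected, since [quarter_square] treats a bound that grows to the right. *)
  have PN z : 4 * P (- z) <= Num.max 0 (2 * z + (K + s)) ^+ 2.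
    by have := Pb (- z); have -> : K + s - 2 * - z = 2 * z + (K + s) by lia.
  have := quarter_square (fun z => P (- z)) _ (- x) (fun z => P_ge0 sh (- z)) PN.
  have -> : - (- x - 1) = x + 1 by lia.
  have -> : - (- x + 1) = x - 1 by lia.
  have -> : 2 * - x + (K + s) = K + s - 2 * x by lia.
  rewrite opprK; lia.
- by have := Pb y; lia.
by have := Pb y; lia.
Qed.

(** A firing outside [a, b] removes nothing from it. For x inside, the parts left of x, at x and
    right of x hold at least 2(x - a) - 1, 3 and 2(b - x) - 1 chips, which add up to the claim; when
    a side is empty, its -1 accounts for the chip leaving there. *)
Lemma step_recurrent (a b : int) : a <= b ->
  (forall i, a <= i -> i <= b -> 1 <= U' i) ->
  2 * (b - a) + 1 <=
  U' (b + 1) - U' b + U' (a - 1) - U' a + (4 * K - 1) * (a <= 0 <= b)%R%:Z.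
Proof.
move=> ab fired.
have old c d : a <= c -> c <= d -> d <= b -> (x < c) || (d < x) ->
    2 * (d - c) + 1 <=
    U (d + 1) - U d + U (c - 1) - U c + (4 * K - 1) * (c <= 0 <= d)%R%:Z.
  move=> ac cd db xcd; apply: (recurrent iv) => // i ci id.
  by have := fired i; rewrite (fires_U st); lia.
rewrite !(fires_U st).
case: (boolP ((x < a) || (b < x))) => xab.
  by have := old a b (lexx a) ab (lexx b) xab; lia.
have cx := balance2 x; have tot := fires_total st.
have L : a < x -> 2 * (x - a) - 1 <=
    U x - U (x - 1) + U (a - 1) - U a + (4 * K - 1) * (a <= 0 <= x - 1)%R%:Z.
  move=> ax; have := old a (x - 1); rewrite subrK => H.
  by have := H ltac:(lia) ltac:(lia) ltac:(lia) ltac:(lia); lia.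
have R : x < b -> 2 * (b - x) - 1 <=
    U (b + 1) - U b + U x - U (x + 1) + (4 * K - 1) * (x + 1 <= 0 <= b)%R%:Z.
  move=> ax; have := old (x + 1) b; rewrite addrK => H.
  by have := H ltac:(lia) ltac:(lia) ltac:(lia) ltac:(lia); lia.
have -> : (a <= 0 <= b)%R%:Z = ((a < x) && (a <= 0 <= x - 1))%R%:Z +
    (x == 0)%:Z + ((x < b) && (x + 1 <= 0 <= b))%R%:Z by lia.
rewrite !mulrDr.
case: (ltP a x) L => ax L; case: (ltP x b) R => xb R.
- by have := L isT; have := R isT; rewrite !andTb; lia.
- have E : b = x by lia.
  by have := L isT; rewrite !andTb !andFb E; lia.
- have E : a = x by lia.
  by have := R isT; rewrite !andTb !andFb E; lia.
have [Ea Eb] : a = x /\ b = x by lia.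
by rewrite !andFb Ea Eb; lia.
Qed.

Lemma step_small_right (v : int) : s <= v ->
  P' (v - 1) - P' v <= Num.max 0 (r' v + s - Num.min v 0).
Proof.
move=> sv; rewrite step_remaining !(fires_P st).
have rx := fired_remaining_gt0; have Zv := small_right iv v sv.
have ord := fires_order st; have sm := fires_small st; have lg := fires_large st.
have Pb := step_P_bound x; have Qb := step_Q_bound x.
rewrite (fires_P st) in Pb; rewrite (fires_Q st) in Qb.
have Zx := P_decr sh (x + 1); rewrite addrK in Zx.
(* In order: three small chips, a mixed triple, three large chips. *)
case: al ga ord sm lg Pb Qb => [] [] ord /= sm lg Pb Qb; try by have := ord isT.
- case: (eqVneq v x) => [E|vx]; first by subst v; lia.
  case: (eqVneq v (x + 1)) => [E|vx1]; last by lia.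
  subst v; rewrite addrK.
  case: (ltP x s) => xs.
    have E : x = s - 1 by lia.
    subst x; rewrite subrK in Zv vx *.
    by have := small_triple_cut rx; rewrite subrK in sm *; lia.
  have := small_triple_right x xs rx; lia.
- by case: (eqVneq v x) => [E|vx]; [subst v|]; lia.
case: (eqVneq v x) => [E|vx]; last by lia.
subst v; have := large_triple_right x sv rx; lia.
Qed.

(** At s - 1 the balance of the new profile turns [step_small_right] at s into the claim; further
    left the triples are examined directly. *)
Lemma step_large_left (i : int) : i < s -> Q' (i + 1) - Q' i <= r' i.
Proof.
move=> i_s; case: (eqVneq i (s - 1)) => [->|is1].
  have := balance sh' s; have := odo_diff K s sK.
  have := step_small_right s (lexx s).
  have : 0 <= r' s by have := step_U_le s; rewrite /remaining; lia.
  by rewrite subrK /remaining; lia.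
have i_s1 : i < s - 1 by lia.
rewrite step_remaining !(fires_Q st).
have rx := fired_remaining_gt0; have Oi := large_left iv i i_s.
have ord := fires_order st; have sm := fires_small st; have lg := fires_large st.
case: al ga ord sm lg => [] [] ord /= sm lg; try by have := ord isT.
- case: (eqVneq i x) => [E|ix]; last by lia.
  by subst i; have := small_triple_left x i_s1 rx; lia.
- by case: (eqVneq i x) => [E|ix]; [subst i|]; lia.
case: (eqVneq i x) => [E|ix]; first by subst i; lia.
case: (eqVneq (i + 1) x) => [E|ix1]; last by lia.
have := large_triple_left x ltac:(lia) rx.
have -> : i = x - 1 by lia.
rewrite subrK; lia.
Qed.

Lemma step_invariant : chip_invariant K s P' Q' U'.
Proof.
by split; [exact: step_Q_bound | exact: step_P_bound | exact: step_U_ge0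
  | exact: step_U_le | exact: step_recurrent | exact: step_large_left
  | exact: step_small_right].
Qed.

End Step.

(** * Stable configurations *)

(** Stability makes r convex except for a defect of at most one at 0. As r >= 0 vanishes at K and
    -K, r(0) > 0 would need a drop on both sides of 0, hence a defect of two; with r(0) = 0,
    convexity on each side finishes. *)
Lemma stable_remaining :
  (forall x : int, P (x - 1) + P (x + 1) - 2 * P x +
             (Q (x - 1) + Q (x + 1) - 2 * Q x) <= 2) ->
  forall x : int, r x = 0.
Proof.
move=> stab.
have conv (x : int) : - K < x -> x < K ->
    2 * r x - (x == 0)%:Z <= r (x - 1) + r (x + 1).
  by move=> xK Kx; have := balance2_remaining x xK Kx; have := stab x; lia.
have rK := remaining_out K; have rNK := remaining_out (- K).
have incr (u : int) : 0 <= u -> u < K -> r u - r (u + 1) <= 0 -> r u <= 0.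
  move=> u0 uK du.
  have slope (v : int) : u <= v -> v < K -> r v - r (v + 1) <= 0.
    move=> uv vK; apply: le_trans du.
    apply: (antitone_int (fun x => r x - r (x + 1))) => // x ux xv.
    by have := conv (x + 1); rewrite addrK; lia.
  have : - r K <= - r u.
    apply: (antitone_int (fun x => - r x)) => [|x ux xK]; first lia.
    by have := slope x; lia.
  lia.
have decr (u : int) : u <= 0 -> - K < u -> r u - r (u - 1) <= 0 -> r u <= 0.
  move=> u0 uK du.
  have slope (v : int) : v <= u -> - K < v -> r v - r (v - 1) <= 0.
    move=> uv vK; apply: le_trans du.
    have : r (u - 1) - r u <= r (v - 1) - r v; last by lia.
    apply: (antitone_int (fun x => r (x - 1) - r x)) => // x ux xv.
    by have := conv x; rewrite addrK; lia.
  have : r u <= r (- K).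
    apply: (antitone_int r) => [|x ux xK]; first lia.
    by have := slope (x + 1); rewrite addrK; lia.
  lia.
have r0 : r 0 <= 0.
  have := conv 0; have := incr 0; have := decr 0; rewrite !add0r; lia.
have pos (x : int) : 0 < x -> r x <= 0.
  move=> x0; rewrite leNgt; apply/negP => rx.
  have xK : x < K by case: (ltP x K) => // ?; have := remaining_out x; lia.
  have dx : 1 <= r x - r (x + 1) by have := incr x; lia.
  have slope (v : int) : 0 <= v -> v <= x -> 1 <= r v - r (v + 1).
    move=> v0 vx; apply: le_trans dx _.
    apply: (antitone_int (fun x => r x - r (x + 1))) => // y vy yx.
    by have := conv (y + 1); rewrite addrK; lia.
  have : r x <= r 0.
    apply: (antitone_int r) => [|y y0 yx]; first lia.
    by have := slope y; lia.
  lia.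
have neg (x : int) : x < 0 -> r x <= 0.
  move=> x0; rewrite leNgt; apply/negP => rx.
  have xK : - K < x by case: (ltP (- K) x) => // ?; have := remaining_out x; lia.
  have dx : 1 <= r x - r (x - 1) by have := decr x; lia.
  have slope (v : int) : x <= v -> v <= 0 -> 1 <= r v - r (v - 1).
    move=> xv v0; apply: le_trans dx _.
    have : r (v - 1) - r v <= r (x - 1) - r x; last by lia.
    apply: (antitone_int (fun x => r (x - 1) - r x)) => // y xy yv.
    by have := conv y; rewrite addrK; lia.
  have : - r 0 <= - r x.
    apply: (antitone_int (fun x => - r x)) => [|y xy y0]; first lia.
    by have := slope (y + 1); rewrite addrK; lia.
  lia.
move=> x; have := remaining_ge0 x; case: (ltgtP x 0) => [/neg|/pos|->]; lia.
Qed.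

End Static.
End Firing.

(** * Chip configurations *)

Section Chips.
Local Open Scope ring_scope.
Variable n : nat.
Implicit Types (A : {set 'I_n}) (p q : config n).

Definition left_sum A p (i : int) : int := \sum_(y in A) Num.max 0 (i - p y).
Definition right_sum A p (i : int) : int := \sum_(y in A) Num.max 0 (p y - i).
(** A firing at x changes the sum only at i = x, by one, and the initial value is subtracted: the
    positions alone thus record the number of firings at i. *)
Definition odometer p (i : int) : int :=
  \sum_(y < n) Num.max 0 (i - p y) - n%:Z * Num.max 0 i.

Lemma sum_indicator A (a : 'I_n) (u : int) :
  \sum_(y in A) (if y == a then u else 0) = (a \in A)%:Z * u.
Proof.
rewrite -big_mkcondr /=; case: (boolP (a \in A)) => aA; last first.
  by rewrite mul0r big1 // => y /andP[yA /eqP E]; rewrite E (negPf aA) in yA.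
rewrite mul1r (big_pred1 a) // => y.
by rewrite /= andbC; case: eqP => [->|].
Qed.

Lemma sum_fire A p (a c : 'I_n) (x : int) (phi : int -> int) :
  a != c -> p a = x -> p c = x ->
  \sum_(y in A) phi (if y == a then p a - 1 else if y == c then p c + 1 else p y) =
  \sum_(y in A) phi (p y) + (a \in A)%:Z * (phi (x - 1) - phi x)
    + (c \in A)%:Z * (phi (x + 1) - phi x).
Proof.
move=> ac ax cx; rewrite -!sum_indicator -!big_split /=; apply: eq_bigr => y _.
case: (eqVneq y a) => [->|ya]; first by rewrite (negPf ac) ax; lia.
by case: (eqVneq y c) => [->|yc]; rewrite ?cx; lia.
Qed.

Lemma site_count_ge A p (a b c : 'I_n) (x : int) :
  a != b -> b != c -> a != c -> p a = x -> p b = x -> p c = x ->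
  (a \in A)%:Z + (b \in A)%:Z + (c \in A)%:Z <= \sum_(y in A) (p y == x)%:Z.
Proof.
move=> ab bc ac ax bx cx.
rewrite -[(a \in A)%:Z]mulr1 -[(b \in A)%:Z]mulr1 -[(c \in A)%:Z]mulr1.
rewrite -!sum_indicator -!big_split /=; apply: ler_sum => y _.
case: (eqVneq y a) => [->|ya]; first by rewrite (negPf ac) (negPf ab) ax eqxx.
case: (eqVneq y b) => [->|yb]; first by rewrite (negPf bc) bx eqxx.
by case: (eqVneq y c) => [->|yc]; rewrite ?cx ?eqxx.
Qed.

Lemma sum_second_diff A (F G H : 'I_n -> int) :
  \sum_(y in A) F y + \sum_(y in A) G y - 2 * \sum_(y in A) H y =
  \sum_(y in A) (F y + G y - 2 * H y).
Proof. by rewrite mulr_sumr -big_split -sumrB. Qed.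

Lemma right_sum2 A p (x : int) :
  right_sum A p (x - 1) + right_sum A p (x + 1) - 2 * right_sum A p x =
  \sum_(y in A) (p y == x)%:Z.
Proof. by rewrite sum_second_diff; apply: eq_bigr => y _; lia. Qed.

Lemma left_sum2 A p (x : int) :
  left_sum A p (x - 1) + left_sum A p (x + 1) - 2 * left_sum A p x =
  \sum_(y in A) (p y == x)%:Z.
Proof. by rewrite sum_second_diff; apply: eq_bigr => y _; lia. Qed.

Lemma sum_setC A (F : 'I_n -> int) :
  \sum_(y in A) F y + \sum_(y in ~: A) F y = \sum_(y < n) F y.
Proof.
rewrite [RHS](bigID (mem A)) /=; congr (_ + _).
by apply: eq_bigl => y; rewrite inE.
Qed.

Lemma sum_setT (F : 'I_n -> int) : \sum_(y in setT) F y = \sum_(y < n) F y.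
Proof. by apply: eq_bigl => y; rewrite inE. Qed.

Lemma sum_one A : \sum_(y in A) 1 = #|A|%:Z :> int.
Proof. by rewrite sumr_const natz. Qed.

(** * Profiles of chips and the initial invariant *)

Variables (K s : int).
Hypotheses (K1 : 1 <= K) (sK : - K < s) (s0 : s <= 0).
Hypothesis nK : n%:Z = 4 * K - 1.
Variable A : {set 'I_n}.
Hypothesis cardA : #|A|%:Z = 2 * (K + s) - 1.

Lemma profile_chips p :
  chip_profile K s (right_sum A p) (left_sum (~: A) p) (odometer p).
Proof.
split=> x.
- by apply: sumr_ge0 => y _; lia.
- by apply: sumr_ge0 => y _; lia.
- by apply: ler_sum => y _; lia.
- by rewrite right_sum2; apply: sumr_ge0.
- by rewrite left_sum2; apply: sumr_ge0.
- rewrite -cardA -sumrB -sum_one; apply: ler_sum => y _; lia.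
have E : \sum_(y in A) (Num.max 0 (x - p y) - Num.max 0 (x - 1 - p y)) =
   #|A|%:Z - (right_sum A p (x - 1) - right_sum A p x).
  rewrite -sum_one -!sumrB; apply: eq_bigr => y _; lia.
have := sum_setC A (fun y => Num.max 0 (x - p y) - Num.max 0 (x - 1 - p y)).
rewrite E !sumrB /odometer -/(left_sum _ _ _) -/(left_sum _ _ _) nK.
have -> : (1 <= x)%R%:Z = Num.max 0 x - Num.max 0 (x - 1) by lia.
move: (Num.max 0 x) (Num.max 0 (x - 1)) => u v.
move: (\sum_(y < n) _) (\sum_(y < n) _) => w z; lia.
Qed.

Lemma right_sum_init (i : int) :
  right_sum A (fun _ => 0) i = (if i <= 0 then (2 * (K + s) - 1) * - i else 0).
Proof.
case: (leP i 0) => i0; last by apply: big1 => y _; lia.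
by rewrite -cardA -sum_one mulr_suml; apply: eq_bigr => y _; lia.
Qed.

Lemma card_large : #|~: A|%:Z = 2 * (K - s).
Proof. by have := cardsC A; rewrite card_ord; lia. Qed.

Lemma left_sum_init (i : int) :
  left_sum (~: A) (fun _ => 0) i = (if 0 <= i then 2 * (K - s) * i else 0).
Proof.
case: (leP 0 i) => i0; last by apply: big1 => y _; lia.
by rewrite -card_large -sum_one mulr_suml; apply: eq_bigr => y _; lia.
Qed.

Lemma odometer_init (i : int) : odometer (fun _ => 0) i = 0.
Proof. by rewrite /odometer sumr_const card_ord subr0 -mulr_natl natz subrr. Qed.

Lemma odo_nneg (L x : int) : 0 <= odo L x.
Proof. exact: sqr_ge0. Qed.

(** The quadratic bounds come from 4uv <= (u + v)^2 with u = 2x, v = K - s and with u = -2x, v = K +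
    s; [recurrent] is vacuous since nothing has fired. *)
Lemma init_invariant :
  chip_invariant K s (right_sum A (fun _ => 0)) (left_sum (~: A) (fun _ => 0))
    (odometer (fun _ => 0)).
Proof.
split=> [x|x|x|x|a b ab fired|i i_s|v sv].
- rewrite left_sum_init; have : 0 <= (2 * x - (K - s)) ^+ 2 by exact: sqr_ge0.
  rewrite !expr2; case: (leP 0 x) => x0; last by nia.
  have -> : Num.max 0 (2 * x + K - s) = 2 * x + K - s by lia.
  nia.
- rewrite right_sum_init; have : 0 <= (2 * x + (K + s)) ^+ 2 by exact: sqr_ge0.
  rewrite !expr2; case: (leP x 0) => x0; last by nia.
  have -> : Num.max 0 (K + s - 2 * x) = K + s - 2 * x by lia.
  nia.
- by rewrite odometer_init.
- by rewrite odometer_init odo_nneg.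
- by have := fired a (lexx a) ab; rewrite odometer_init.
- rewrite /remaining odometer_init !left_sum_init.
  have := odo_nneg K i; case: (leP 0 i); case: (leP 0 (i + 1)); nia.
rewrite /remaining odometer_init !right_sum_init.
case: (leP v 0) => v1; last by case: (leP (v - 1) 0); nia.
have -> : (v - 1 <= 0) by lia.
rewrite odo_le0 ?expr2; nia.
Qed.

(** * Reachable configurations and the sorted cut *)

Section Reach.
Variables (d : Order.disp_t) (T : orderType d) (lab : 'I_n -> T).
Hypothesis A_down : forall x y, x \in A -> (lab y <= lab x)%O -> y \in A.

Lemma fire_fires p q : fire_step lab p q ->
  exists x al ga, fires x al ga
    (right_sum A p) (left_sum (~: A) p) (odometer p)
    (right_sum A q) (left_sum (~: A) q) (odometer q).
Proof.
move=> [a [b [c [lab_ab lab_bc pab pbc qE]]]].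
have ab : a != b by apply: contraTneq lab_ab => ->; rewrite ltxx.
have bc : b != c by apply: contraTneq lab_bc => ->; rewrite ltxx.
have ac : a != c by apply: contraTneq (lt_trans lab_ab lab_bc) => ->; rewrite ltxx.
have pc : p c = p a by rewrite pab pbc.
have sumq (B : {set 'I_n}) (phi : int -> int) :
    \sum_(y in B) phi (q y) = \sum_(y in B) phi (p y) +
    (a \in B)%:Z * (phi (p a - 1) - phi (p a)) +
    (c \in B)%:Z * (phi (p a + 1) - phi (p a)).
  by rewrite qE; apply: sum_fire.
have count B := site_count_ge B p a b c (p a) ab bc ac erefl (esym pab) pc.
have bA : (c \in A) ==> (b \in A).
  by apply/implyP => cA; apply: A_down cA (ltW lab_bc).
have aA : (b \in A) ==> (a \in A).
  by apply/implyP => bA'; apply: A_down bA' (ltW lab_ab).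
exists (p a), (a \in A), (c \in A); split; rewrite ?right_sum2 ?left_sum2.
- move=> i; rewrite /right_sum (sumq A (fun u => Num.max 0 (u - i))).
  by case: (a \in A); case: (c \in A) => /=; rewrite -!addrA; congr (_ + _); lia.
- move=> i; rewrite /left_sum (sumq (~: A) (fun u => Num.max 0 (i - u))) !inE.
  by case: (a \in A); case: (c \in A) => /=; rewrite -!addrA; congr (_ + _); lia.
- move=> i; rewrite /odometer.
  have := sumq setT (fun u => Num.max 0 (i - u)).
  rewrite !sum_setT !in_setT => /= ->.
  by rewrite -!addrA; congr (_ + _); lia.
- by move=> cA; apply: (implyP aA); apply: (implyP bA).
- apply: le_trans (count A).
  by move: aA bA; case: (a \in A); case: (b \in A); case: (c \in A).
- apply: le_trans (count (~: A)); rewrite !inE.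
  by move: aA bA; case: (a \in A); case: (b \in A); case: (c \in A).
apply: le_trans (lerD (count A) (count (~: A))); rewrite !inE.
by move: aA bA; case: (a \in A); case: (b \in A); case: (c \in A).
Qed.

Lemma reachable_invariant p : reachable lab (fun _ => 0) p ->
  chip_invariant K s (right_sum A p) (left_sum (~: A) p) (odometer p).
Proof.
elim=> [|q q' _ IH /fire_fires[x [al [ga st]]]]; first exact: init_invariant.
exact: (step_invariant _ _ _ _ _ K1 sK s0 (profile_chips q) IH _ _ _ _ _ _
  (profile_chips q') st).
Qed.

(** Site -K never fires, and its odometer is the total distance of the chips beyond it. *)
Lemma position_ge p (y : 'I_n) : reachable lab (fun _ => 0) p -> - K <= p y.
Proof.
move=> /reachable_invariant inv.
have := U_le inv (- K); rewrite odo_out; last by lia.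
rewrite /odometer (_ : Num.max 0 (- K) = 0); last by lia.
rewrite mulr0 subr0 => sum_le0.
suff : Num.max 0 (- K - p y) <= 0 by lia.
apply: le_trans sum_le0; rewrite (bigD1 y) //= lerDl.
by apply: sumr_ge0 => i _; lia.
Qed.

Lemma small_chip_lt p (y : 'I_n) :
  reachable lab (fun _ => 0) p -> terminal p -> (y \in A) = (p y < s).
Proof.
move=> /reachable_invariant inv term.
have rem0 : forall x : int, remaining K (odometer p) x = 0.
  apply: (stable_remaining _ _ _ _ _ K1 sK s0 (profile_chips p) inv) => x.
  rewrite right_sum2 left_sum2 sum_setC.
  have := term x; rewrite -lez_nat -sum_one big_mkcond.
  by apply: le_trans; apply: ler_sum => i _; rewrite inE; case: (p i == x).
(* With r = 0 no large chip is left of the cut, and the balance at s then leaves no small chip at or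
   right of it. *)
have Os := large_left inv (s - 1); rewrite rem0 subrK in Os.
have bal := balance_remaining _ _ _ _ _ K1 sK s0 (profile_chips p) s sK ltac:(lia).
rewrite !rem0 in bal.
case: (boolP (y \in A)) => yA.
  have Zs : right_sum A p (s - 1) - right_sum A p s <= 0.
    by have := Os ltac:(lia); lia.
  rewrite -sumrB in Zs.
  suff : Num.max 0 (p y - (s - 1)) - Num.max 0 (p y - s) <= 0 by lia.
  apply: le_trans Zs; rewrite (bigD1 y) //= lerDl.
  by apply: sumr_ge0 => i _; lia.
have {}Os := Os ltac:(lia); rewrite -sumrB in Os.
suff : Num.max 0 (s - p y) - Num.max 0 (s - 1 - p y) <= 0 by lia.
apply: le_trans Os; rewrite (bigD1 y) ?inE //= lerDl.
by apply: sumr_ge0 => i _; lia.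
Qed.

End Reach.
End Chips.

(** * Sorting *)

Section Sorting.
Local Open Scope ring_scope.

Lemma lower_set (d : Order.disp_t) (T : orderType d) (n : nat) (lab : 'I_n -> T)
    (m : nat) : injective lab -> (m <= n)%N ->
  exists2 A : {set 'I_n}, #|A| = m &
    forall x y, x \in A -> (lab y <= lab x)%O -> y \in A.
Proof.
move=> lab_inj; elim: m => [|m IH] mn.
  by exists set0 => [|x y]; rewrite ?cards0 // inE.
have [A cA down] := IH (ltnW mn).
have /card_gt0P[x0 x0A] : (0 < #|~: A|)%N.
  by have := cardsC A; rewrite card_ord cA; lia.
case: (arg_minP lab x0A) => z zA zmin.
have {}zA : z \notin A by rewrite -in_setC.
exists (z |: A) => [|x y]; first by rewrite cardsU1 cA zA.
rewrite !inE => xzA yx; apply/orP; case: (boolP (y \in A)) => yA; [by right | left].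
have zy : (lab z <= lab y)%O by apply: zmin; have : y \in ~: A by rewrite in_setC.
case/orP: xzA => [/eqP E|xA]; last by rewrite (down x y xA yx) in yA.
by apply/eqP/lab_inj/le_anti; rewrite zy -E yx.
Qed.

Lemma left_half_sorted (d : Order.disp_t) (T : orderType d) (n : nat)
    (lab : 'I_n -> T) (p : config n) (a b : 'I_n) :
  injective lab -> (n %% 4 = 3)%N -> reachable lab (fun _ => 0) p -> terminal p ->
  (lab a < lab b)%O -> p b < 0 -> p a <= p b.
Proof.
move=> lab_inj n3 reach term ab b0.
pose K : int := (n %/ 4)%N.+1%:Z.
have nK : n%:Z = 4 * K - 1 by rewrite /K; lia.
have K1 : 1 <= K by rewrite /K; lia.
(* The cut s = 0, with 2K - 1 small chips, serves only to obtain -K <= p(b). *)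
have [A0 cA0 down0] := lower_set _ _ _ lab (n %/ 4 * 2 + 1)%N lab_inj ltac:(lia).
have bK : - K <= p b.
  by apply: (position_ge _ K 0 K1 _ _ nK A0 _ _ _ _ down0 p b reach);
     rewrite ?cA0 /K; lia.
(* The cut just right of b: b is small, hence so is a. *)
pose s : int := p b + 1.
have [A cA down] :=
  lower_set _ _ _ lab (absz (2 * (K + s) - 1)%R) lab_inj ltac:(lia).
have cut y : (y \in A) = (p y < s).
  by apply: (small_chip_lt _ K s K1 _ _ nK A _ _ _ _ down p y reach term);
     rewrite ?cA /s; lia.
have bA : b \in A by rewrite cut /s; lia.
by have := down _ _ bA (ltW ab); rewrite cut /s; lia.
Qed.

(** Reflection swaps the outer chips of a triple and reverses the label order. The configuration is
    rebuilt move by move and agrees with the reflection pointwise, because [fire_step] prescribes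
    the new function itself. *)
Lemma reachable_reflect (d : Order.disp_t) (T : orderType d) (n : nat)
    (lab : 'I_n -> T) (p : config n) :
  reachable lab (fun _ => 0) p ->
  exists2 q : config n, q =1 (fun y => - p y) &
    reachable (lab : 'I_n -> T^d) (fun _ => 0) q.
Proof.
elim=> [|q q' _ [r rq IH] [a [b [c [ab bc pab pbc ->]]]]].
  by exists (fun _ => 0) => [y|]; [rewrite oppr0 | exact: reach_refl].
have ac : a != c by apply: contraTneq (lt_trans ab bc) => ->; rewrite ltxx.
exists (fun y => if y == c then r c - 1 else if y == a then r a + 1 else r y).
  have ca : (c == a) = false by rewrite eq_sym (negPf ac).
  move=> y; rewrite !rq; case: eqP => [->|_]; first by rewrite ca; lia.
  by case: eqP => _; lia.
apply: reach_step IH _; exists c, b, a; split=> //.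
- by rewrite !rq -pbc.
- by rewrite !rq pab.
Qed.

End Sorting.

Theorem theorem3p13 (d : Order.disp_t) (T : orderType d) (n : nat)
    (lab : 'I_n -> T) (lab_inj : injective lab) :
  n %% 4 = 3 ->
  forall p : config n,
    reachable lab (fun _ => 0%R) p -> terminal p ->
    forall a b : 'I_n, (lab a < lab b)%O -> (p a <= p b)%R.
Proof.
move=> n3 p reach term a b ab.
case: (ltP (p b) 0%R) => pb.
  exact: left_half_sorted lab_inj n3 reach term ab pb.
case: (leP (p a) 0%R) => pa; first exact: le_trans pa pb.
(* Now p(a) > 0, so after reflection a has the larger label and a negative position. *)
have [q qE qreach] := reachable_reflect _ _ _ _ _ reach.
have qterm : terminal q.
  move=> i; apply: leq_trans (term (- i)%R); apply: subset_leq_card.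
  by apply/subsetP => y; rewrite !inE qE => /eqP <-; rewrite opprK.
have := left_half_sorted _ T^d _ lab q b a lab_inj n3 qreach qterm ab.
by rewrite !qE; lia.
Qed.
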